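(* Let $M$ be a locally compact Hausdorff topological monoid and $E$ a Banach space. Assume that $M$ is extendible to a locally compact Hausdorff topological group $G$, and that $M$ (viewed as a subset of $G$) is positive in the identity. Then every semigroup $T : M \to \mathfrak{L}(E)$ over $E$ defined over $M$ which is continuous with respect to the weak operator topology is automatically continuous with respect to the strong operator topology.
   Context: Monoids and groups are written multiplicatively with identity $1$; no commutativity is assumed. $\mathfrak{L}(E)$ denotes the bounded linear operators on the Banach space $E$, $\mathbf{I}$ the identity operator, and $E'$ the continuous dual of $E$. A semigroup over $E$ defined over a monoid $M$ is any function $T : M \to \mathfrak{L}(E)$ with $T(1) = \mathbf{I}$ and $T(st) = T(s)T(t)$ for all $s,t \in M$. $T$ is continuous with respect to the weak operator topology if $t \mapsto \langle T(t)x, \varphi\rangle$ is continuous on $M$ for all $x \in E$, $\varphi \in E'$; it is continuous with respect to the strong operator topology if $t \mapsto T(t)x \in E$ is norm-continuous on $M$ for all $x \in E$. A locally compact Hausdorff topological monoid $M$ is called extendible (to $G$) if there exists a locally compact Hausdorff topological group $G$ such that $M$ is topologically and algebraically isomorphic to a closed subset of $G$. In this case one identifies $M$ with that closed subset, so that $M \subseteq G$. A subset $A \subseteq G$ of a locally compact Hausdorff group $G$ is called positive in the identity if for every neighbourhood $U \subseteq G$ of the group identity, $U \cap A$ has non-empty interior within $G$. *)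

(* Defs.v *)
From HB Require Import structures.
From mathcomp Require Import all_boot all_order all_algebra.
From mathcomp Require Import all_classical all_reals all_analysis.
From mathcomp Require Import complex.

Set Implicit Arguments.
Unset Strict Implicit.
Unset Printing Implicit Defensive.

Import Order.TTheory GRing.Theory Num.Theory.
Import numFieldNormedType.Exports.

Local Open Scope classical_set_scope.
Local Open Scope ring_scope.

HB.mixin Record Monoid_isTopological M & Topological M & Monoid M := {
  mulg_continuous : continuous (fun p : M * M => (p.1 * p.2)%g)
}.

#[short(type="topologicalMonoidType")]
HB.structure Definition TopologicalMonoid :=
  {M of Topological M & Monoid M & Monoid_isTopological M}.

HB.mixin Record TopologicalMonoid_isTopologicalGroup G
    & Topological G & Group G := {
  invg_continuous : continuous (fun g : G => (g^-1)%g)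
}.

#[short(type="topologicalGroupType")]
HB.structure Definition TopologicalGroup :=
  {G of TopologicalMonoid G & Group G & TopologicalMonoid_isTopologicalGroup G}.

(* [iota] identifies [M], algebraically and topologically, with the closed
   subset [range iota] of [G]; the last clause says that [iota] is open onto
   its image. *)
Definition closed_embedding (M : topologicalMonoidType)
    (G : topologicalGroupType) (iota : M -> G) : Prop :=
  [/\ monoid.monoid_morphism iota,
      injective iota,
      continuous iota,
      closed (range iota) &
      forall U : set M, open U ->
        exists2 V : set G, open V & iota @` U = V `&` range iota].

Definition positive_in_identity (G : topologicalGroupType) (A : set G) : Prop :=
  forall U : set G, nbhs (1%g : G) U -> interior (U `&` A) !=set0.

Definition real_or_complex (R : realType) (K : numFieldType) : Prop :=
  K = (R : numFieldType) \/ K = (R[i] : numFieldType).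

Section Operators.
Context {K : numFieldType}.

(* For a linear map, boundedness near 0 is equivalent to
   [`|f x| <= r * `|x|] for some [r] and all [x]: see [linear_boundedP]. *)
Record bounded_operator (E : normedModType K) := BoundedOperator {
  operator_map :> {linear E -> E};
  operator_bounded : bounded_near operator_map (nbhs (0 : E))
}.

Record continuous_dual (E : normedModType K) := ContinuousDual {
  functional_map :> {linear E -> K^o};
  functional_continuous : continuous (functional_map : E -> K^o)
}.

Context {M : topologicalMonoidType} {E : normedModType K}.
Implicit Type T : M -> bounded_operator E.

Definition operator_semigroup T : Prop :=
  (forall x, T 1%g x = x) /\ (forall s t x, T (s * t)%g x = T s (T t x)).

Definition weak_operator_continuous T : Prop :=
  forall (x : E) (phi : continuous_dual E),
    continuous ((fun t => phi (T t x)) : M -> K^o).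

Definition strong_operator_continuous T : Prop :=
  forall x : E, continuous ((fun t => T t x) : M -> E).

End Operators.

(* Main.v *)
Require Import Defs.
From HB Require Import structures.
From mathcomp Require Import all_boot all_order all_algebra.
From mathcomp Require Import all_classical all_reals all_analysis.
From mathcomp Require Import complex.
From mathcomp Require Import ring lra.

Set Implicit Arguments.
Unset Strict Implicit.
Unset Printing Implicit Defensive.

Import Order.TTheory GRing.Theory Num.Theory.
Import numFieldNormedType.Exports.

Local Open Scope classical_set_scope.
Local Open Scope ring_scope.

(** Why weak continuity implies strong continuity.

Fix a point [s] of the monoid and a vector [x]. The obstruction to norm
continuity of [t |-> T t x] at [s] is measured by the number
  [q x = limsup_(t -> s) |T t x - T s x|],
and [q] is a seminorm in [x]. Near [s] the operators [T t] have norms bounded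
by some [C] (two applications of the uniform boundedness principle, the first
one in the dual), so [q] is dominated by a multiple of the norm. By the
Hahn-Banach theorem some functional [phi], dominated by [2 q] and hence
continuous, satisfies [q x <= |phi x|]. It therefore suffices to show
[phi x = 0], and since [T r x] tends weakly to [x] as [r -> 1], to find [r]
arbitrarily close to [1] with [q (T r x)] arbitrarily small.

Such [r] exist for two reasons. First, a weakly continuous map from a locally
compact Hausdorff space into a normed space is fragmented by the norm: every
nonempty open set contains a nonempty open set [W] whose image has diameter at
most [e] ([weakly_continuous_fragmented]). Second, since the monoid is positive
in the identity, [W] can be taken close to [1] and inside the interior of the
monoid in the group. If [r] lies in [W] and [t] is close to [s], the group
element [s^-1 t r] is close to [r], hence belongs to [W]: thus [t r = s w] with
[w] in [W] ([embedding_right_translate]), and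
  [|T t (T r x) - T s (T r x)| = |T s (T w x - T r x)| <= C e].

Fragmentation is proved by a topological game. If it fails on an open set, one
can choose a decreasing sequence of open sets [V n] and points [x n] in
[V (n+1)] such that [f] maps [V (n+1)] at distance at least [e / 8] from a
totally bounded set [Q n], where the [Q n] exhaust the linear span of the
vectors [f (x n)]. A cluster point [p] of the sequence lies in every [V n], so
[f p] is at positive distance from this span; but [f p] belongs to the weak
closure of the span, which contradicts the Hahn-Banach theorem.

All real and complex cases are treated at once: seminorms take values in [R],
and the scalars [K] are used only through the interface [real_scalars]. *)

(** * The real structure of the scalar field *)

(** One interface for [R] and [R[i]], so that every later proof is common to
both. The element [im_unit] is [0] in the real case and the imaginary unit in
the complex case; with this convention [scalar_decomp] is the decomposition
into real and imaginary parts, as the imaginary part of [z] is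
[- re (im_unit * z)]. *)
Record real_scalars (R : realType) (K : numFieldType) := RealScalars {
  inR :> {rmorphism R -> K};
  re : K -> R;
  im_unit : K;
  inR_le : {mono inR : a b / a <= b};
  re_add : forall y z, re (y + z) = re y + re z;
  re_scale : forall a z, re (inR a * z) = a * re z;
  inR_reK : forall z, 0 <= z -> inR (re z) = z;
  norm_re_le : forall z, `|re z| <= re `|z|;
  scalar_decomp : forall z,
    z = inR (re z) - im_unit * inR (re (im_unit * z));
  im_unitP : im_unit = 0 \/ im_unit * im_unit = -1
}.

Definition real_scalars_id (R : realType) : real_scalars R R.
Proof.
apply: (@RealScalars R R idfun id 0) => //.
- by move=> z; rewrite /= mul0r subr0.
- by left.
Defined.

Lemma real_or_complex_scalars (R : realType) (K : numFieldType) :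
  real_or_complex R K -> inhabited (real_scalars R K).
Proof.
case=> ->; constructor; first exact: real_scalars_id.
apply: (@RealScalars R R[i] (real_complex R) (@complex.Re R) 'i%C).
- exact: lecR.
- by move=> [a b] [c d].
- by move=> a [b c] /=; rewrite mul0r subr0.
- by move=> z z0; exact: (RRe_real (ger0_real z0)).
- move=> [a b]; rewrite normc_def /=.
  by rewrite -sqrtr_sqr ler_wsqrtr// lerDl sqr_ge0.
- by move=> [a b]; rewrite /=; simpc.
- by right; rewrite -expr2 sqr_i.
Qed.

(** * The real Hahn-Banach theorem *)

Section HahnBanach.
Context {R : realType} {V : lmodType R}.
Implicit Types (p q : V -> R) (x y : V) (A : set R).

Definition sublinear p :=
  (forall x y, p (x + y) <= p x + p y) /\
  (forall a x, 0 <= a -> p (a *: x) <= a * p x).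

Lemma sublinear0 p : sublinear p -> p 0 = 0.
Proof.
move=> [pD pZ]; apply/eqP; rewrite eq_le; apply/andP; split.
  by have := pZ 0 0 (lexx 0); rewrite scale0r mul0r.
by have := pD 0 0; rewrite addr0; lra.
Qed.

Lemma sublinear_ge p x : sublinear p -> - p (- x) <= p x.
Proof.
move=> ps; have := ps.1 x (- x); rewrite subrr (sublinear0 ps); lra.
Qed.

(** Sublinear functionals below are infima of sets of admissible values; this
reduces sublinearity to closure properties of the admissible values. *)
Lemma inf_family_sublinear (P : V -> set R) :
  (forall x, P x !=set0) -> (forall x, has_lbound (P x)) ->
  (forall x y a b, P x a -> P y b -> exists2 c, P (x + y) c & c <= a + b) ->
  (forall a x b, 0 <= a -> P x b -> exists2 c, P (a *: x) c & c <= a * b) ->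
  sublinear (fun x => inf (P x)).
Proof.
move=> P0 Plb PD PZ; split=> [x y|a x a0].
  rewrite -lerBlDr; apply: lb_le_inf => // a Pa.
  rewrite lerBlDr -lerBlDl; apply: lb_le_inf => // b Pb.
  have [c Pc cab] := PD _ _ _ _ Pa Pb.
  by rewrite lerBlDl (le_trans _ cab)// ge_inf.
have [->|an0] := eqVneq a 0.
  have [b Pb] := P0 x; have [c Pc] := PZ _ _ _ (lexx 0) Pb.
  by rewrite !mul0r; apply: le_trans; exact: ge_inf.
have {an0}a0 : 0 < a by rewrite lt_neqAle eq_sym an0.
rewrite -ler_pdivrMl//; apply: lb_le_inf => // b Pb.
have [c Pc cab] := PZ _ _ _ (ltW a0) Pb.
by rewrite ler_pdivrMl// (le_trans _ cab)// ge_inf.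
Qed.

Lemma sublinearZ p a x : sublinear p -> 0 <= a -> p (a *: x) = a * p x.
Proof.
move=> ps; rewrite le_eqVlt => /predU1P[<-|a0].
  by rewrite scale0r sublinear0// mul0r.
apply/eqP; rewrite eq_le (ps.2 _ _ (ltW a0))/= -ler_pdivlMl//.
have := ps.2 a^-1 (a *: x).
by rewrite scalerA mulVf ?gt_eqF// scale1r; apply; rewrite invr_ge0 ltW.
Qed.

(** [tilt p y] is the largest sublinear functional below [p] which takes the
value [- p y] or less at [- y]. A functional that cannot be lowered by any
tilt is additive, and one tilt at [x0] forces the value at [x0] of every
linear functional below it. *)
Definition tilt_values p y x :=
  [set c | exists2 t, 0 <= t & c = p (x + t *: y) - t * p y].

Definition tilt p y x := inf (tilt_values p y x).

Lemma tilt_lbound p y x : sublinear p ->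
  lbound (tilt_values p y x) (- p (- x)).
Proof.
move=> ps c [t t0 ->]; rewrite -(sublinearZ _ ps t0).
have := ps.1 (x + t *: y) (- x); rewrite addrC addKr; lra.
Qed.

Lemma tilt_le p y x t : sublinear p -> 0 <= t ->
  tilt p y x <= p (x + t *: y) - t * p y.
Proof.
by move=> ps t0; apply: ge_inf; [exists (- p (- x)); exact: tilt_lbound|exists t].
Qed.

Lemma tilt_sublinear p y : sublinear p -> sublinear (tilt p y).
Proof.
move=> ps; apply: inf_family_sublinear.
- by move=> x; exists (p (x + 0 *: y) - 0 * p y), 0.
- by move=> x; exists (- p (- x)); exact: tilt_lbound.
- move=> x x' a b [s s0 ->] [t t0 ->].
  exists (p (x + x' + (s + t) *: y) - (s + t) * p y).
    by exists (s + t) => //; exact: addr_ge0.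
  by rewrite scalerDl addrACA; have := ps.1 (x + s *: y) (x' + t *: y); lra.
- move=> a x b a0 [t t0 ->].
  exists (p (a *: x + (a * t) *: y) - (a * t) * p y).
    by exists (a * t) => //; exact: mulr_ge0.
  by rewrite -scalerA -scalerDr (sublinearZ _ ps a0) mulrBr mulrA.
Qed.

(** Zorn's lemma: a chain has its pointwise infimum as a lower bound, which is
finite because [- q (- x) <= - p (- x) <= p x] for every [p] below [q]. *)
Lemma minimal_sublinear q : sublinear q -> exists p,
  [/\ sublinear p, forall x, p x <= q x &
      forall p', sublinear p' -> (forall x, p' x <= p x) -> p' = p].
Proof.
move=> qs.
pose dominated p := sublinear p /\ forall x, p x <= q x.
pose T := {p : V -> R | dominated p}.
pose below (s t : T) := `[< forall x, sval t x <= sval s x >].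
have chain_bound (A : set T) : total_on A below ->
    exists t, forall s, A s -> below s t.
  move=> tA; have [[s0 As0]|A0] := pselect (A !=set0); last first.
    by exists (exist dominated q (conj qs (fun x => lexx (q x)))) => s As;
      case: A0; exists s.
  pose P x := [set sval s x | s in A].
  have Plb x : lbound (P x) (- q (- x)).
    move=> _ [[p [ps pq]] _ <-] /=.
    by apply: le_trans (sublinear_ge x ps); rewrite lerN2.
  have Ps : sublinear (fun x => inf (P x)).
    apply: inf_family_sublinear.
    - by move=> x; exists (sval s0 x), s0.
    - by move=> x; exists (- q (- x)).
    - move=> x y _ _ [s As <-] [t At <-].
      wlog /asboolP st : s t As At x y / below s t.
        move=> W; have [st|ts] := tA _ _ As At; first exact: W.
        have [c Pc cts] := W _ _ At As y x ts.
        by exists c; rewrite 1?(addrC x)// 1?addrC.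
      exists (sval t (x + y)); first by exists t.
      apply: le_trans ((svalP t).1.1 x y) _.
      by rewrite lerD2r.
    - move=> a x _ a0 [s As <-]; exists (sval s (a *: x)); first by exists s.
      exact: (svalP s).1.2.
  have Pq x : inf (P x) <= q x.
    apply: le_trans ((svalP s0).2 x).
    by apply: ge_inf; [exists (- q (- x))|exists s0].
  exists (exist dominated _ (conj Ps Pq)) => s As; apply/asboolP => x /=.
  by apply: ge_inf; [exists (- q (- x))|exists s].
have [[p [ps pq]] pmin] : exists t, forall s, below t s -> s = t.
  apply: Zorn chain_bound.
  - by move=> t; apply/asboolP.
  - move=> r s t /asboolP rs /asboolP st; apply/asboolP => x.
    exact: le_trans (st x) (rs x).
  - move=> s t /asboolP st /asboolP ts.
    case: s t st ts => [p' p'P] [p pP] /= p_le p'_le.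
    have pE : p' = p by apply/funext => x; apply/eqP; rewrite eq_le p_le p'_le.
    by case: _ / pE pP {p_le p'_le} => pP; congr exist; exact: Prop_irrelevance.
exists p; split=> // p' p's p'p.
have p'q x : p' x <= q x := le_trans (p'p x) (pq x).
have /pmin pE : below (exist dominated p (conj ps pq))
    (exist dominated p' (conj p's p'q)) by apply/asboolP.
exact: (congr1 sval pE).
Qed.

(** By minimality [tilt p y = p], and the value [t = 1] in the definition of
the tilt gives [p x <= p (x + y) - p y], the reverse of subadditivity. *)
Lemma minimal_sublinear_linear p : sublinear p ->
  (forall p', sublinear p' -> (forall x, p' x <= p x) -> p' = p) ->
  (forall x y, p (x + y) = p x + p y) /\ (forall a x, p (a *: x) = a * p x).
Proof.
move=> ps pmin.
have pD x y : p (x + y) = p x + p y.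
  apply/eqP; rewrite eq_le ps.1/=.
  have tp : tilt p y = p.
    apply: pmin; first exact: tilt_sublinear.
    by move=> z; have := tilt_le y z ps (lexx 0); rewrite scale0r addr0 mul0r subr0.
  by have := tilt_le y x ps ler01; rewrite tp scale1r mul1r lerBrDr.
have pN x : p (- x) = - p x.
  by apply/eqP; rewrite -addr_eq0 -pD addNr sublinear0.
split=> // a x; have [a0|a0] := leP 0 a; first exact: sublinearZ.
by rewrite -[a]opprK scaleNr pN sublinearZ ?mulNr// oppr_ge0 ltW.
Qed.

(** Minimal sublinear functionals replace the usual extension of a functional
from a line: tilting [q] at [x0] before minimizing gives [g (- x0) <= - q x0]. *)
Theorem Hahn_Banach q x0 : sublinear q -> exists g : V -> R,
  [/\ forall x y, g (x + y) = g x + g y, forall a x, g (a *: x) = a * g x,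
      forall x, g x <= q x & q x0 <= g x0].
Proof.
move=> qs; have [g [gs gq gmin]] := minimal_sublinear (tilt_sublinear x0 qs).
have [gD gZ] := minimal_sublinear_linear gs gmin.
exists g; split=> //.
  move=> x; apply: le_trans (gq x) _.
  by have := tilt_le x0 x qs (lexx 0); rewrite scale0r addr0 mul0r subr0.
have := le_trans (gq (- x0)) (tilt_le x0 (- x0) qs ler01).
by rewrite scale1r addNr sublinear0// mul1r sub0r -scaleN1r gZ mulN1r lerN2.
Qed.

End HahnBanach.
(** * Functionals dominated by a seminorm *)

Definition restrict_scalars (R K : nzRingType) (f : {rmorphism R -> K})
  (V : lmodType K) : Type := V.

Section RestrictScalars.
Context {R K : nzRingType} (f : {rmorphism R -> K}) (V : lmodType K).

HB.instance Definition _ := GRing.Zmodule.on (restrict_scalars f V).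

Let scale (a : R) (x : restrict_scalars f V) : restrict_scalars f V :=
  f a *: (x : V).

Let scaleA a b x : scale a (scale b x) = scale (a * b) x.
Proof. by rewrite /scale scalerA rmorphM. Qed.

Let scale1 : left_id 1 scale.
Proof. by move=> x; rewrite /scale rmorph1 scale1r. Qed.

Let scaleDr : right_distributive scale +%R.
Proof. by move=> a x y; exact: scalerDr. Qed.

Let scaleDl x : {morph scale^~ x : a b / a + b}.
Proof. by move=> a b; rewrite /scale rmorphD scalerDl. Qed.

HB.instance Definition _ := GRing.Zmodule_isLmodule.Build R
  (restrict_scalars f V) scaleA scale1 scaleDr scaleDl.

End RestrictScalars.

(** The norm of a normed module over [K] has values in [K]; suprema, infima and
total comparisons need its real version. *)
Definition real_norm (R : realType) (K : numFieldType) (S : real_scalars R K)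
  (E : normedZmodType K) (x : E) : R := re S `|x|.

Section RealNorm.
Context {R : realType} {K : numFieldType} (S : real_scalars R K).
Local Notation nrm := (real_norm S).

Lemma inR_nrm (E : normedZmodType K) (x : E) : S (nrm x) = `|x|.
Proof. exact/inR_reK. Qed.

Lemma nrm_ge0 (E : normedZmodType K) (x : E) : 0 <= nrm x.
Proof. by rewrite -(inR_le S) rmorph0 inR_nrm. Qed.

Lemma nrm0 (E : normedZmodType K) : nrm (0 : E) = 0.
Proof. by apply: (fmorph_inj S); rewrite inR_nrm normr0 rmorph0. Qed.

Lemma nrmN (E : normedZmodType K) (x : E) : nrm (- x) = nrm x.
Proof. by rewrite /real_norm normrN. Qed.

Lemma nrm_distC (E : normedZmodType K) (x y : E) : nrm (x - y) = nrm (y - x).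
Proof. by rewrite -nrmN opprB. Qed.

Lemma nrmD (E : normedZmodType K) (x y : E) : nrm (x + y) <= nrm x + nrm y.
Proof. by rewrite -(inR_le S) rmorphD !inR_nrm; exact: ler_normD. Qed.

Lemma nrmB (E : normedZmodType K) (x y : E) : nrm (x - y) <= nrm x + nrm y.
Proof. by rewrite -(nrmN y); exact: nrmD. Qed.

Lemma nrm_dist_trans (E : normedZmodType K) (y x z : E) :
  nrm (x - z) <= nrm (x - y) + nrm (y - z).
Proof. by rewrite -{1}(subrK y x) -addrA; exact: nrmD. Qed.

Lemma nrm_lb (E : normedZmodType K) (x y : E) : nrm x - nrm y <= nrm (x - y).
Proof. by have := nrmD (x - y) y; rewrite subrK; lra. Qed.

Lemma nrm_inR a : nrm (S a) = `|a|.
Proof.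
wlog a0 : a / 0 <= a.
  move=> W; have [|/ltW a0] := leP 0 a; first exact: W.
  by rewrite -[a]opprK rmorphN nrmN normrN; apply: W; rewrite oppr_ge0.
apply: (fmorph_inj S); rewrite inR_nrm !ger0_norm//.
by rewrite -(rmorph0 S) inR_le.
Qed.

Lemma nrmZ (E : normedModType K) (c : K) (x : E) :
  nrm (c *: x) = nrm c * nrm x.
Proof. by apply: (fmorph_inj S); rewrite rmorphM !inR_nrm normrZ. Qed.

Lemma nrmM (c d : K) : nrm (c * d) = nrm c * nrm d.
Proof. by apply: (fmorph_inj S); rewrite rmorphM !inR_nrm normrM. Qed.

Lemma nrm1 : nrm (1 : K) = 1.
Proof. by rewrite -(rmorph1 S) nrm_inR normr1. Qed.

Lemma nrm_im_unit : nrm (im_unit S) <= 1.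
Proof.
have [->|/(congr1 (fun z : K => nrm z))] := im_unitP S; first by rewrite nrm0.
by rewrite nrmM nrmN nrm1 => /eqP; rewrite -expr2 sqrp_eq1 ?nrm_ge0// => /eqP ->.
Qed.

Lemma re1 : re S 1 = 1.
Proof. by apply: (fmorph_inj S); rewrite rmorph1 inR_reK. Qed.

Lemma re_inR a : re S (S a) = a.
Proof. by rewrite -[S a]mulr1 re_scale re1 mulr1. Qed.

Lemma re_im_unit : re S (im_unit S) = 0.
Proof.
have := scalar_decomp S 1; rewrite re1 mulr1 rmorph1 => /esym/eqP.
rewrite -subr_eq0 addrC addKr oppr_eq0 mulf_eq0 => /orP[/eqP ->|].
  by rewrite -(rmorph0 S) re_inR.
by rewrite fmorph_eq0 => /eqP.
Qed.

(** A seminorm presented by the constants that bound it: [P x c] reads as the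
seminorm of [x] being at most [c]. Distances to subspaces and upper limits of
norms satisfy these closure properties directly, without reference to the
infimum that is the value of the seminorm. *)
Definition gauge (V : lmodType K) (P : V -> set R) :=
  [/\ forall x, P x !=set0,
      forall x c, P x c -> 0 <= c,
      forall x y c d, P x c -> P y d -> P (x + y) (c + d) &
      forall k x c, P x c -> P (k *: x) (nrm k * c)].

(** The Hahn-Banach theorem over [K]. A real-linear [g] below the seminorm [q]
is the real part of the [K]-linear functional [g x - i g (i x)]. The constant
[2] comes from bounding both terms by [q x]. *)
Lemma gauge_functional (V : lmodType K) (P : V -> set R) (x0 : V) :
  gauge P -> exists phi : {linear V -> K^o},
    (forall x c, P x c -> nrm (phi x) <= 2 * c) /\
    (forall d, lbound (P x0) d -> d <= nrm (phi x0)).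
Proof.
move=> [P_ex P_ge0 PD PZ].
pose W : lmodType R := restrict_scalars S V.
pose q (x : W) := inf (P x).
have Plb x : has_lbound (P x) by exists 0 => c; exact: P_ge0.
have qs : sublinear q.
  apply: inf_family_sublinear => //.
    by move=> x y a b Pa Pb; exists (a + b) => //; exact: PD.
  move=> a x b a0 Pb; exists (a * b) => //.
  by have := PZ (S a) x b Pb; rewrite nrm_inR ger0_norm.
have [g [gD gZ gq gx0]] := Hahn_Banach (x0 : W) qs.
have gZ' a (x : V) : g (S a *: x) = a * g x by exact: gZ.
have gle x c : P x c -> g x <= c.
  by move=> Pc; apply: le_trans (gq x) _; exact: ge_inf.
have gnorm x c : P x c -> `|g x| <= c.
  move=> Pc; rewrite ler_norml gle// andbT.
  have := gle _ _ (PZ (-1) x c Pc); rewrite nrmN nrm1 mul1r => gN.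
  by have := gZ' (-1) x; rewrite rmorphN rmorph1 mulN1r => gNx; rewrite lerNl -gNx.
pose j := im_unit S.
pose phi (x : V) : K^o := S (g x) - j * S (g (j *: x)).
have phiD x y : phi (x + y) = phi x + phi y.
  by rewrite /phi scalerDr !gD !rmorphD /=; ring.
have phi_real a x : phi (S a *: x) = S a * phi x.
  have jS : j *: (S a *: x) = S a *: (j *: x) by rewrite !scalerA mulrC.
  by rewrite /phi jS !gZ' !rmorphM; ring.
have g0 : g (0 : V) = 0 by have := gD 0 0; rewrite addr0; lra.
have phi_im x : phi (j *: x) = j * phi x.
  rewrite /phi; have [j0|jj] : j = 0 \/ j * j = -1 := im_unitP S.
    by rewrite j0 !scale0r !mul0r g0 rmorph0 subr0.
  have -> : j *: (j *: x) = S (-1) *: x by rewrite scalerA jj rmorphN rmorph1.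
  by rewrite gZ' mulN1r rmorphN mulrBr mulrA jj; ring.
have phi_lin : linear phi.
  move=> c x y; rewrite phiD; congr (_ + _).
  pose a := re S c; pose b := re S (j * c).
  have cE : c = S a + S (- b) * j.
    by rewrite {1}(scalar_decomp S c) rmorphN mulNr (mulrC (S b)).
  by rewrite {1}cE scalerDl -scalerA phiD !phi_real phi_im mulrA -mulrDl -cE.
pose phi_linear : {linear V -> K^o} :=
  HB.pack phi (GRing.isLinear.Build K V K^o *:%R phi phi_lin).
exists phi_linear; split=> [x c Pc|d dP].
  apply: le_trans (nrmB _ _) _; rewrite nrmM !nrm_inR.
  have Pjc : P (j *: x) (nrm j * c) := PZ _ _ _ Pc.
  have c0 := P_ge0 _ _ Pc.
  have j_c : nrm j * `|g (j *: x)| <= c.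
    apply: le_trans (ler_wpM2l (nrm_ge0 j) (gnorm _ _ Pjc)) _.
    have := nrm_im_unit; rewrite -/j => j1.
    by rewrite mulrA ler_piMl// mulr_ile1 ?nrm_ge0.
  by have := gnorm _ _ Pc; lra.
have -> : nrm (phi_linear x0) = nrm (phi x0) by [].
have re_phi : re S (phi x0) = g x0.
  rewrite /phi re_add re_inR -mulrN -rmorphN mulrC re_scale.
  by rewrite re_im_unit mulr0 addr0.
apply: le_trans (norm_re_le S (phi x0)); rewrite re_phi.
apply: le_trans (ler_norm _); apply: le_trans gx0.
exact: lb_le_inf.
Qed.

Lemma continuous_nrmP (X : topologicalType) (E : normedModType K)
  (f : X -> E) (t : X) :
  {for t, continuous f} <->
  (forall e : R, 0 < e -> \forall t' \near t, nrm (f t - f t') < e).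
Proof.
split=> [/cvgrPdist_lt ft e e0|ft].
  have Se0 : 0 < S e by rewrite -(rmorph0 S) (leW_mono (inR_le S)).
  apply: filterS (ft _ Se0) => t'.
  by rewrite -inR_nrm (leW_mono (inR_le S)).
apply/cvgrPdist_lt => e e0.
have ee : S (re S e) = e by rewrite inR_reK ?ltW.
have re0 : 0 < re S e by rewrite -(leW_mono (inR_le S)) rmorph0 ee.
apply: filterS (ft _ re0) => t'.
by rewrite -(leW_mono (inR_le S)) inR_nrm ee.
Qed.

Lemma bounded_functional_continuous (E : normedModType K)
  (phi : {linear E -> K^o}) (C : R) :
  (forall x, nrm (phi x) <= C * nrm x) -> continuous (phi : E -> K^o).
Proof.
move=> phiC x; apply/continuous_nrmP => e e0.
have C1 : 0 < `|C| + 1 by rewrite ltr_wpDl.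
have /continuous_nrmP/(_ (e / (`|C| + 1)))idx : {for x, continuous (@id E)} by [].
have {}idx := idx (divr_gt0 e0 C1).
apply: filterS idx => y; rewrite ltr_pdivlMr// => xy.
rewrite -linearB; apply: le_lt_trans (phiC _) _.
apply: le_lt_trans xy; rewrite mulrC ler_wpM2l ?nrm_ge0//.
by have := ler_norm C; lra.
Qed.

Definition dual_of_bounded (E : normedModType K) (phi : {linear E -> K^o})
    (C : R) (phiC : forall x, nrm (phi x) <= C * nrm x) : continuous_dual E :=
  ContinuousDual (bounded_functional_continuous phiC).

End RealNorm.
(** * The gliding hump *)

Section GlidingHump.
Context {R : realType} {K : numFieldType} (S : real_scalars R K).
Local Notation nrm := (real_norm S).
Local Notation r n := (9^-1 ^+ n : R).

Lemma ninth_gt0 n : 0 < r n.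
Proof. by rewrite exprn_gt0// invr_gt0. Qed.

Lemma ninth_small (a e : R) : 0 < e -> exists n, a * r n < e.
Proof.
move=> e0; have A0 : 0 < `|a| + 1 by rewrite ltr_wpDl.
have : (fun n => r n) @ \oo --> (0 : R).
  by apply: cvg_expr; rewrite ger0_norm ?invr_ge0// invf_lt1// ltr1n.
move=> /cvgrPdist_lt/(_ _ (divr_gt0 e0 A0)) [n _ /(_ n (leqnn n))] /=.
rewrite sub0r normrN ger0_norm; last exact/ltW/ninth_gt0.
rewrite ltr_pdivlMr// => rn; exists n; apply: le_lt_trans rn.
rewrite mulrC ler_wpM2l; first by [].
  exact/ltW/ninth_gt0.
by have := ler_norm a; lra.
Qed.

Lemma le0_ninth (a b : R) : (forall n, b <= a * r n) -> b <= 0.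
Proof.
move=> ab; rewrite leNgt; apply/negP => b0.
by have [n] := ninth_small a b0; rewrite ltNge ab.
Qed.

(** An abstract uniform boundedness principle, meant for the unit ball [B] of a
Banach space and for the unit ball of a dual space alike: the completeness
hypothesis asks that series with terms [9^-n v_n], [v_n] in [B], converge with
the expected rate. If the seminorms were not uniformly bounded on [B], humps
[v_n] could be chosen one after the other such that [p i] nearly attains its
supremum over [B] at [v_n], is huge there, and the partial sum keeps the hump.
The remaining terms are too small to destroy it: they contribute at most
[4 / 9 * 3 / 2 = 2 / 3] of the hump, so the sum of the series would be a
multiple of an element of [B] on which the seminorms are unbounded. *)
Lemma gliding_hump (V : lmodType K) (B : set V) (I : Type) (p : I -> V -> R) :
  (forall v, B v -> B (- v)) ->
  (forall v : nat -> V, (forall n, B (v n)) -> exists w, forall n,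
     exists2 b, B b & w = \sum_(k < n) S (r k) *: v k + S (4 * r n) *: b) ->
  (forall i x y, p i (x + y) <= p i x + p i y) ->
  (forall i a x, p i (S a *: x) = `|a| * p i x) ->
  (forall i, exists C, forall v, B v -> p i v <= C) ->
  (forall v, B v -> exists C, forall i, p i v <= C) ->
  exists C, forall i v, B v -> p i v <= C.
Proof.
move=> BN B_complete pD pZ p_bounded p_pointwise; apply: contrapT => unbounded.
have pN i x : p i (- x) = p i x.
  by rewrite -scaleN1r -(rmorph1 S) -rmorphN pZ normrN normr1 mul1r.
pose hump (ns : nat * V) v := B v /\ exists i,
  [/\ ns.1%:R <= r ns.1 * p i v, forall u, B u -> p i u <= 3 / 2 * p i v &
      r ns.1 * p i v <= p i (ns.2 + S (r ns.1) *: v)].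
have /choice[F F_hump] : forall ns, exists v, hump ns v.
  move=> [n s].
  have [q q0 qE] : exists2 q : R, 0 <= q & n%:R = q * r n.
    exists (n%:R / r n); last by rewrite divfK// gt_eqF// ninth_gt0.
    by rewrite divr_ge0// ltW// ninth_gt0.
  have [i [v0 [Bv0 v0_big]]] :
      exists i v, B v /\ 3 / 2 * q < p i v.
    apply: contrapT => H; apply: unbounded; exists (3 / 2 * q).
    by move=> i v Bv; rewrite leNgt; apply/negP => pv; apply: H; exists i, v.
  have [C pC] := p_bounded i.
  pose values := [set p i v | v in B].
  have values_sup : has_sup values.
    by split; [exists (p i v0), v0|exists C => _ [v Bv <-]; exact: pC].
  have v0_le : p i v0 <= sup values by apply: ub_le_sup; [exact: values_sup.2|exists v0].
  have sup_gt0 : 0 < sup values by lra.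
  have gap0 : 0 < sup values / 3 by rewrite divr_gt0.
  have [_ [v Bv <-] v_big] := sup_adherent gap0 values_sup.
  have v_max u : B u -> p i u <= 3 / 2 * p i v.
    move=> Bu; have : p i u <= sup values.
      by apply: ub_le_sup; [exact: values_sup.2|exists u].
    lra.
  have v_n : n%:R <= r n * p i v.
    have qv : q <= p i v by lra.
    by rewrite qE mulrC ler_pM2l// ninth_gt0.
  (* One of the two signs keeps the hump, because the two candidates differ by
     twice the hump. *)
  have two_v : 2 * (r n * p i v) <=
      p i (s + S (r n) *: v) + p i (s + S (r n) *: (- v)).
    rewrite -(pN i (s + S (r n) *: (- v))); apply: le_trans (pD _ _ _).
    rewrite opprD addrACA subrr add0r -scalerN opprK -scalerDl -rmorphD pZ.
    by rewrite -mulr2n normrMn ger0_norm ?(ltW (ninth_gt0 n))// !mulrnAl mul1r.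
  have [le_plus|lt_plus] := leP (r n * p i v) (p i (s + S (r n) *: v)).
    by exists v; split=> //; exists i.
  exists (- v); split; first exact: BN.
  exists i; rewrite pN; split=> //=; lra.
pose fix s n := if n is m.+1 then s m + S (r m) *: F (m, s m) else 0.
pose v n := F (n, s n).
have sE n : s n = \sum_(k < n) S (r k) *: v k.
  by elim: n => [|n IHn]; rewrite ?big_ord0// big_ord_recr/= -IHn.
have [w w_tail] : exists w, forall n,
    exists2 b, B b & w = s n + S (4 * r n) *: b.
  have [|w w_tail] := B_complete v; first by move=> n; exact: (F_hump _).1.
  by exists w => n; rewrite sE.
have [b0 Bb0 w0] := w_tail 0.
have [C pC] := p_pointwise _ Bb0.
pose n := (Num.truncn (12 * C)).+1.
have n_large : 12 * C < n%:R by rewrite truncnS_gt.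
have [_ [i [/= v_n v_max v_hump]]] := F_hump (n, s n).
have [b Bb wE] := w_tail n.+1.
have pw : p i w <= 4 * C.
  rewrite w0 add0r pZ expr0 mulr1 ger0_norm//.
  by rewrite ler_wpM2l.
have : p i (s n.+1) <= p i w + 4 * r n.+1 * (3 / 2 * p i (v n)).
  have -> : s n.+1 = w - S (4 * r n.+1) *: b by rewrite wE addrK.
  apply: le_trans (pD _ _ _) _; rewrite lerD2l pN pZ ger0_norm; last first.
    by rewrite mulr_ge0// ltW ?ninth_gt0.
  by rewrite ler_wpM2l ?v_max// mulr_ge0// ltW ?ninth_gt0.
rewrite exprS -/(v n) in v_n v_hump *.
have -> : s n.+1 = s n + S (r n) *: v n by [].
by lra.
Qed.

(** The completeness hypothesis of [gliding_hump] for a Banach space. *)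
Lemma geometric_series_cvg (E : completeNormedModType K) (v : nat -> E) (M : R) :
  (forall n, nrm (v n) <= M) -> exists w, forall n,
    nrm (w - \sum_(k < n) S (r k) *: v k) <= 2 * M * r n.
Proof.
move=> vM; pose s n := \sum_(k < n) S (r k) *: v k.
have M0 : 0 <= M := le_trans (nrm_ge0 S _) (vM 0).
have s_dist n m : nrm (s n - s (n + m)%N) <= 9 / 8 * M * (r n - r (n + m)%N).
  elim: m => [|m IHm]; first by rewrite addn0 !subrr nrm0 mulr0.
  apply: le_trans (nrm_dist_trans S (s (n + m)%N) _ _) _.
  rewrite addnS /s big_ord_recr/= -/(s _) opprD addrA subrr sub0r nrmN nrmZ.
  rewrite nrm_inR ger0_norm; last exact/ltW/ninth_gt0.
  have := ler_wpM2l (ltW (ninth_gt0 (n + m))) (vM (n + m)%N).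
  by rewrite exprS; move: IHm; lra.
have s_le n m : (n <= m)%N -> nrm (s n - s m) <= 9 / 8 * M * r n.
  move=> /subnKC <-; apply: le_trans (s_dist _ _) _.
  rewrite ler_wpM2l ?mulr_ge0// lerBlDr lerDl; exact/ltW/ninth_gt0.
have : cvg (s @ \oo).
  apply: cauchy_cvg; apply: cauchy_exP => e e0.
  have re0 : 0 < re S e by rewrite -(leW_mono (inR_le S)) rmorph0 inR_reK ?ltW.
  have [n rn] := ninth_small (9 / 8 * M) re0.
  exists (s n), n => // m /= nm; rewrite -ball_normE /=.
  rewrite -(inR_nrm S) -(inR_reK S (ltW e0)) (leW_mono (inR_le S)).
  exact: le_lt_trans (s_le _ _ nm) rn.
move=> /cvg_ex[w sw]; exists w => n; rewrite -/(s n).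
apply/ler_addgt0Pr => e e0.
have Se0 : 0 < S e by rewrite -(rmorph0 S) (leW_mono (inR_le S)).
move: sw => /cvgrPdist_lt/(_ _ Se0)[m _ /(_ (maxn m n) (leq_maxl _ _))] /=.
rewrite -(inR_nrm S) (leW_mono (inR_le S)) => sw.
apply: le_trans (nrm_dist_trans S (s (maxn m n)) _ _) _.
have := s_le _ _ (leq_maxr m n).
rewrite (nrm_distC S (s n)) => sn.
have := mulr_ge0 M0 (ltW (ninth_gt0 n)).
by move: sw sn; lra.
Qed.

End GlidingHump.
(** * Uniform boundedness *)

Section UniformBoundedness.
Context {R : realType} {K : numFieldType} (S : real_scalars R K).
Local Notation nrm := (real_norm S).
Local Notation r n := (9^-1 ^+ n : R).

(** The scalars are complete because their real and imaginary parts are. *)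
Lemma scalar_series_cvg (c : nat -> K) (M : R) : (forall n, nrm (c n) <= M) ->
  exists w : K, forall n, nrm (w - \sum_(k < n) S (r k) * c k) <= 4 * M * r n.
Proof.
move=> cM; have M0 : 0 <= M := le_trans (nrm_ge0 S _) (cM 0).
pose j := im_unit S; pose a n := re S (c n); pose b n := re S (j * c n).
have aM n : real_norm (real_scalars_id R) (a n : R^o) <= M.
  exact: le_trans (norm_re_le S (c n)) (cM n).
have bM n : real_norm (real_scalars_id R) (b n : R^o) <= M.
  apply: le_trans (norm_re_le S (j * c n)) _.
  rewrite -/(nrm _) nrmM; apply: le_trans (cM n).
  by rewrite ler_piMl ?nrm_ge0// nrm_im_unit.
have [u /= ucvg] := geometric_series_cvg aM.
have [v /= vcvg] := geometric_series_cvg bM.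
exists (S u - j * S v) => n.
have -> : \sum_(k < n) S (r k) * c k =
    S (\sum_(k < n) r k * a k) - j * S (\sum_(k < n) r k * b k).
  rewrite !rmorph_sum mulr_sumr -sumrB; apply: eq_bigr => k _.
  by rewrite {1}(scalar_decomp S (c k)) !rmorphM -/j -/(a k) -/(b k); ring.
rewrite (_ : _ - _ = S (u - \sum_(k < n) r k * a k) -
    j * S (v - \sum_(k < n) r k * b k)); last by rewrite !rmorphB; ring.
apply: le_trans (nrmB _ _ _) _; rewrite nrmM !nrm_inR.
have := ler_wpM2r (normr_ge0 (v - \sum_(k < n) r k * b k)) (nrm_im_unit S).
rewrite mul1r -/j => jv.
have un : `|u - \sum_(k < n) r k * a k| <= 2 * M * r n := ucvg n.
have vn : `|v - \sum_(k < n) r k * b k| <= 2 * M * r n := vcvg n.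
by lra.
Qed.

Lemma scale_to_unit_ball (E F : normedModType K) (T : {linear E -> F}) (C : R) :
  (forall x, nrm x <= 1 -> nrm (T x) <= C) ->
  forall x, nrm (T x) <= C * nrm x.
Proof.
move=> TC x; have [x0|x0] := eqVneq (nrm x) 0.
  have -> : x = 0 by apply/normr0_eq0; rewrite -(inR_nrm S) x0 rmorph0.
  by rewrite linear0 !nrm0 mulr0.
have {}x0 : 0 < nrm x by rewrite lt_neqAle eq_sym x0 nrm_ge0.
have := TC (S (nrm x)^-1 *: x).
rewrite linearZ /= !nrmZ nrm_inR ger0_norm ?invr_ge0 ?nrm_ge0//.
by rewrite mulVf ?gt_eqF// mulrC ler_pdivrMr// => /(_ (lexx _)).
Qed.

Theorem uniform_boundedness (E : completeNormedModType K) (F : normedModType K)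
    (I : Type) (T : I -> {linear E -> F}) :
  (forall i, exists C, forall x, nrm (T i x) <= C * nrm x) ->
  (forall x, exists C, forall i, nrm (T i x) <= C) ->
  exists C, forall i x, nrm (T i x) <= C * nrm x.
Proof.
move=> T_bounded T_pointwise.
suff [C TC] : exists C, forall i x, nrm x <= 1 -> nrm (T i x) <= C.
  by exists C => i; apply: scale_to_unit_ball => x; exact: TC.
apply: (gliding_hump (S := S) (B := [set x : E | nrm x <= 1])
    (p := fun i x => nrm (T i x))).
- by move=> x /=; rewrite nrmN.
- move=> v v1; have [w wcvg] := geometric_series_cvg v1.
  exists w => n; have r4 : 0 < 4 * r n by rewrite mulr_gt0// ninth_gt0.
  exists (S (4 * r n)^-1 *: (w - \sum_(k < n) S (r k) *: v k)) => /=.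
    rewrite nrmZ nrm_inR ger0_norm ?invr_ge0 ?(ltW r4)// ler_pdivrMl//.
    by have := @ninth_gt0 R n; have := wcvg n; lra.
  by rewrite scalerA -rmorphM divff ?gt_eqF// rmorph1 scale1r addrC subrK.
- by move=> i x y; rewrite linearD; exact: nrmD.
- by move=> i a x; rewrite linearZ nrmZ nrm_inR.
- move=> i; have [C TC] := T_bounded i; exists `|C| => x /= x1.
  apply: le_trans (TC x) _; apply: le_trans (ler_wpM2r (nrm_ge0 S x) (ler_norm C)) _.
  by rewrite ler_piMr.
- by move=> x _; exact: T_pointwise.
Qed.

Lemma norm_gauge (E : normedModType K) :
  gauge S (fun x : E => [set c | nrm x <= c]).
Proof.
split=> [x|x c /=|x y c d /=|k x c /=].
- by exists (nrm x) => /=.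
- by apply: le_trans; exact: nrm_ge0.
- by move=> xc yd; apply: le_trans (nrmD _ _ _) (lerD xc yd).
- by move=> xc; rewrite nrmZ ler_wpM2l ?nrm_ge0.
Qed.

Lemma norming_functional (E : normedModType K) (x0 : E) :
  exists phi : {linear E -> K^o},
    (forall x, nrm (phi x) <= 2 * nrm x) /\ nrm x0 <= nrm (phi x0).
Proof.
have [phi [phi_le phi_x0]] := gauge_functional x0 (@norm_gauge E).
by exists phi; split=> [x|]; [apply: phi_le => /=|apply: phi_x0].
Qed.

(** Uniform boundedness in the dual: the hump argument is run on the unit ball
of linear functionals, where series converge pointwise. *)
Lemma weakly_bounded_bounded (E : normedModType K) (I : Type) (f : I -> E) :
  (forall phi : continuous_dual E, exists C, forall i, nrm (phi (f i)) <= C) ->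
  exists C, forall i, nrm (f i) <= C.
Proof.
move=> f_weakly.
pose B : set (E -> K^o) := [set phi | linear phi /\ forall x, nrm (phi x) <= nrm x].
have [C fC] : exists C, forall i phi, B phi -> nrm (phi (f i)) <= C.
  apply: (gliding_hump (S := S) (p := fun i (phi : E -> K^o) => nrm (phi (f i)))).
  - move=> phi [phi_lin phi1]; split=> [a x y|x]; last by rewrite nrmN.
    by rewrite /= !fctE phi_lin scalerN opprD.
  - move=> v v1; pose s n x : K := \sum_(k < n) S (r k) * v k x.
    have sD n a x y : s n (a *: x + y) = a * s n x + s n y.
      rewrite mulr_sumr -big_split; apply: eq_bigr => k _ /=.
      rewrite [v k _](v1 k).1 -[(a *: _)%R]/(a * v k x); ring.
    have /choice[w wcvg] : forall x, exists w : K, forall n,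
        nrm (w - s n x) <= 4 * nrm x * r n.
      move=> x; apply: (@scalar_series_cvg (fun n => v n x)) => n.
      exact: (v1 n).2.
    have wD a x y : w (a *: x + y) = a * w x + w y.
      apply/eqP; rewrite -subr_eq0; apply/eqP/normr0_eq0.
      rewrite -(inR_nrm S) -(rmorph0 S); congr (S _).
      apply/eqP; rewrite eq_le nrm_ge0 andbT.
      apply: (@le0_ninth _ (4 * nrm (a *: x + y) + nrm a * (4 * nrm x) + 4 * nrm y)).
      move=> n; have -> : w (a *: x + y) - (a * w x + w y) =
        (w (a *: x + y) - s n (a *: x + y)) - a * (w x - s n x) - (w y - s n y).
        by rewrite sD; ring.
      apply: le_trans (nrmB _ _ _) _; rewrite mulrDl; apply: lerD; last exact: wcvg.
      apply: le_trans (nrmB _ _ _) _; rewrite mulrDl; apply: lerD; first exact: wcvg.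
      by rewrite nrmM -mulrA ler_wpM2l ?nrm_ge0//; exact: wcvg.
    exists (w : E -> K^o) => n.
    have r4 : 0 < 4 * r n by rewrite mulr_gt0// ninth_gt0.
    pose b x : K^o := S (4 * r n)^-1 * (w x - s n x).
    exists b.
      split=> [a x y|x].
        by rewrite /b wD sD -[(a *: _)%R]/(a * b x) /b; ring.
      rewrite nrmM nrm_inR ger0_norm ?invr_ge0 ?(ltW r4)// ler_pdivrMl// mulrAC.
      exact: wcvg.
    apply/funext => x; rewrite fctE fct_sumE -[RHS]/(s n x + S (4 * r n) * b x).
    by rewrite mulrA -rmorphM divff ?gt_eqF// rmorph1 mul1r addrC subrK.
  - by move=> i phi psi; exact: nrmD.
  - move=> i a phi; rewrite -(nrm_inR S); exact: nrmM.
  - by move=> i; exists (nrm (f i)) => phi [_ phi1]; exact: phi1.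
  - move=> phi [phi_lin phi1].
    pose phi' : {linear E -> K^o} :=
      HB.pack phi (GRing.isLinear.Build K E K^o *:%R phi phi_lin).
    have phi'1 x : nrm (phi' x) <= 1 * nrm x by rewrite mul1r; exact: phi1.
    by have [C phiC] := f_weakly (dual_of_bounded phi'1); exists C.
exists (2 * C) => i.
have [phi [phi_le phi_fi]] := norming_functional (f i).
pose half : E -> K^o := fun x => S 2^-1 * phi x.
have half_in : B half.
  split=> [a x y|x]; first by rewrite /half linearP -![(a *: _)%R]/(a * _); ring.
  rewrite nrmM nrm_inR ger0_norm ?invr_ge0// ler_pdivrMl//; exact: phi_le.
have := fC i _ half_in; rewrite nrmM nrm_inR ger0_norm ?invr_ge0// ler_pdivrMl//.
exact: le_trans.
Qed.

Lemma bounded_operator_bound (E : normedModType K) (T : bounded_operator E) :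
  exists C, forall x, nrm (T x) <= C * nrm x.
Proof.
have /linear_boundedP[M [Mreal TM]] := operator_bounded T.
have M1 : M < `|M| + 1 by rewrite (le_lt_trans (real_ler_norm Mreal))// ltrDl.
exists (re S (`|M| + 1)) => x; rewrite -(inR_le S) rmorphM inR_reK ?addr_ge0//.
by rewrite !inR_nrm; exact: TM.
Qed.

End UniformBoundedness.
(** * Finite nets *)

Section FiniteNets.
Context {R : realType} {K : numFieldType} (S : real_scalars R K).
Local Notation nrm := (real_norm S).

Definition finite_nets (E : normedModType K) (A : set E) :=
  forall e : R, 0 < e -> exists L : seq E,
    forall x, A x -> exists2 y, y \in L & nrm (x - y) <= e.

Lemma real_finite_nets (M e : R) : 0 < e -> exists L : seq R,
  forall a, `|a| <= M -> exists2 b, b \in L & `|a - b| <= e.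
Proof.
move=> e0; exists [seq k%:R * e - M | k <- iota 0 (Num.truncn (2 * M / e)).+1].
move=> a aM; have M0 : 0 <= M := le_trans (normr_ge0 a) aM.
have /andP[aM1 aM2] : - M <= a <= M by rewrite -ler_norml.
have q0 : 0 <= (a + M) / e by rewrite divr_ge0 ?(ltW e0)//; lra.
pose k := Num.truncn ((a + M) / e).
exists (k%:R * e - M).
  apply/mapP; exists k => //.
  rewrite mem_iota add0n /= ltnS le_truncn//.
  by rewrite ler_pM2r ?invr_gt0// mulr_natl mulr2n lerD2r.
have /andP[] := truncn_itv q0; rewrite -/k.
rewrite ler_pdivlMr// ltr_pdivrMr// -(natr1 k) mulrDl mul1r => lo hi.
rewrite ler_norml; apply/andP; split; lra.
Qed.

Lemma ball_finite_nets (M : R) : finite_nets [set c : K^o | nrm c <= M].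
Proof.
move=> e e0; have e2 : 0 < e / 2 by rewrite divr_gt0.
have [L LP] := real_finite_nets M e2.
pose j := im_unit S.
exists [seq (S a - j * S b : K^o) | a <- L, b <- L] => c /= cM.
have [a aL ca] := LP _ (le_trans (norm_re_le S c) cM).
have jcM : nrm (j * c) <= M.
  by rewrite nrmM; apply: le_trans cM; rewrite ler_piMl ?nrm_ge0// nrm_im_unit.
have [b bL cb] := LP _ (le_trans (norm_re_le S (j * c)) jcM).
exists (S a - j * S b); first by apply/allpairsP; exists (a, b).
rewrite {1}(scalar_decomp S c) -/j.
rewrite (_ : _ - _ = S (re S c - a) - j * S (re S (j * c) - b)); last first.
  by rewrite !rmorphB; ring.
apply: le_trans (nrmB _ _ _) _; rewrite nrmM !nrm_inR.
have := ler_wpM2r (normr_ge0 (re S (j * c) - b)) (nrm_im_unit S).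
by rewrite mul1r -/j; lra.
Qed.

Lemma finite_netsD (E : normedModType K) (A B : set E) :
  finite_nets A -> finite_nets B ->
  finite_nets [set z | exists x y, [/\ A x, B y & z = x + y]].
Proof.
move=> An Bn e e0; have e2 : 0 < e / 2 by rewrite divr_gt0.
have [L LP] := An _ e2; have [L' LP'] := Bn _ e2.
exists [seq x + y | x <- L, y <- L'] => _ [x [y [/LP[x' x'L xx'] /LP'[y' y'L yy'] ->]]].
exists (x' + y'); first by apply/allpairsP; exists (x', y').
rewrite opprD addrACA; apply: le_trans (nrmD _ _ _) _; lra.
Qed.

Lemma finite_netsZ (E : normedModType K) (M : R) (A : set E) :
  finite_nets A -> finite_nets [set z | exists c x, [/\ nrm c <= M, A x & z = c *: x]].
Proof.
move=> An e e0.
have e1 : 0 < e / 2 / (`|M| + 1) by rewrite !divr_gt0// ltr_wpDl.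
have [L LP] := An _ e1.
pose C := \sum_(y <- L) nrm y.
have C0 : 0 <= C by apply: sumr_ge0 => y _; exact: nrm_ge0.
have LC y : y \in L -> nrm y <= C.
  move=> yL; rewrite /C (big_rem y)//= lerDl.
  by apply: sumr_ge0 => z _; exact: nrm_ge0.
have e2 : 0 < e / 2 / (C + 1) by rewrite !divr_gt0// ltr_wpDl.
have [N NP] := ball_finite_nets M e2.
exists [seq (c : K) *: x | c <- N, x <- L].
move=> _ [c [x [cM Ax ->]]].
have [y yL xy] := LP _ Ax; have [d dN cd] := NP _ cM.
exists ((d : K) *: y); first by apply/allpairsP; exists (d, y).
have -> : c *: x - (d : K) *: y = c *: (x - y) + (c - d) *: y.
  by rewrite scalerBr scalerBl addrA subrK.
apply: le_trans (nrmD _ _ _) _; rewrite !nrmZ.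
have M1 : 0 < `|M| + 1 by rewrite ltr_wpDl.
have C1 : 0 < C + 1 by rewrite ltr_wpDl.
have cxy : nrm c * nrm (x - y) <= e / 2.
  move: xy; rewrite ler_pdivlMr// mulrC; apply: le_trans.
  by rewrite ler_wpM2r ?nrm_ge0//; move: cM; have := ler_norm M; lra.
have cdy : nrm (c - d) * nrm y <= e / 2.
  move: cd; rewrite ler_pdivlMr//; apply: le_trans.
  by rewrite ler_wpM2l ?nrm_ge0//; have := LC _ yL; lra.
lra.
Qed.

Lemma finite_nets1 (E : normedModType K) (x : E) : finite_nets [set x].
Proof.
move=> e e0; exists [:: x] => _ ->; exists x; first by rewrite mem_head.
by rewrite subrr nrm0 ltW.
Qed.

Lemma finite_netsU (E : normedModType K) (A B : set E) :
  finite_nets A -> finite_nets B -> finite_nets (A `|` B).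
Proof.
move=> An Bn e e0; have [L LP] := An _ e0; have [L' LP'] := Bn _ e0.
exists (L ++ L') => x [/LP|/LP'] [y yL xy]; exists y => //.
  by rewrite mem_cat yL.
by rewrite mem_cat yL orbT.
Qed.

(** One step of the exhaustion of a linear span by totally bounded sets: when
[M] grows from one step to the next, every sum and every multiple of elements
already reached is reached later. *)
Definition combinations (E : normedModType K) (M : R) (A : set E) : set E :=
  [set z | exists u v,
     [/\ [set z | exists c x, [/\ nrm c <= M, A x & z = c *: x]] u,
         [set z | exists c x, [/\ nrm c <= M, A x & z = c *: x]] v & z = u + v]].

Lemma finite_nets_combinations (E : normedModType K) (M : R) (A : set E) :
  finite_nets A -> finite_nets (combinations M A).
Proof. by move=> An; apply: finite_netsD; exact: finite_netsZ. Qed.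

Lemma combinationsP (E : normedModType K) (M : R) (A : set E) (c d : K) x y :
  A x -> A y -> nrm c <= M -> nrm d <= M -> combinations M A (c *: x + d *: y).
Proof.
by move=> Ax Ay cM dM; exists (c *: x), (d *: y); split=> //; [exists c, x|exists d, y].
Qed.

End FiniteNets.

(** * Fragmentation of weakly continuous maps *)

Section Fragmentation.
Context {R : realType} {K : numFieldType} (S : real_scalars R K).
Context {E : normedModType K} {X : topologicalType} (f : X -> E).
Local Notation nrm := (real_norm S).
Context (f_weakly : forall phi : continuous_dual E,
  continuous ((fun t => phi (f t)) : X -> K^o)).

Definition scattered_on (U : set X) (e : R) := forall W : set X,
  open W -> W !=set0 -> W `<=` U -> exists x y, [/\ W x, W y & e < nrm (f x - f y)].

Lemma norming_dual (x0 : E) : exists phi : continuous_dual E,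
  (forall x, nrm (phi x) <= 2 * nrm x) /\ nrm x0 <= nrm (phi x0).
Proof.
have [phi [phi_le phi_x0]] := norming_functional S x0.
by exists (dual_of_bounded phi_le).
Qed.

Lemma open_dual_gt (phi : continuous_dual E) (y : E) (c : R) :
  open [set x | c < nrm (phi (f x - y))].
Proof.
rewrite openE => x /= cx; have d0 : 0 < nrm (phi (f x - y)) - c by rewrite subr_gt0.
have /(continuous_nrmP S)/(_ _ d0) := @f_weakly phi x.
apply: filterS => t /= xt.
have diffE : phi (f x - y) - phi (f t - y) = phi (f x) - phi (f t).
  by rewrite -!linearB opprB addrA subrK.
have := nrm_lb S (phi (f x - y)) (phi (f t - y)); rewrite diffE; lra.
Qed.

(** Two values of [f] on [V] are [e] apart, so one of them is far from [y]. A
norming functional turns this into a weakly open condition. *)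
Lemma avoid_point (U V : set X) (e : R) (y : E) : 0 < e -> scattered_on U e ->
  open V -> V !=set0 -> V `<=` U -> exists W : set X,
  [/\ open W, W !=set0, W `<=` V & forall x, W x -> e / 4 < nrm (f x - y)].
Proof.
move=> e0 Ue oV V0 VU.
have [x1 Vx1 x1y] : exists2 x, V x & e / 2 < nrm (f x - y).
  have [x1 [x2 [Vx1 Vx2 x12]]] := Ue V oV V0 VU.
  have [x1y|x1y] := ltP (e / 2) (nrm (f x1 - y)); first by exists x1.
  exists x2 => //; have := nrm_dist_trans S y (f x1) (f x2).
  rewrite (nrm_distC S y); lra.
have [phi [phi_le phi_x1]] := norming_dual (f x1 - y).
exists (V `&` [set x | e / 2 < nrm (phi (f x - y))]); split.
- by apply: openI => //; exact: open_dual_gt.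
- by exists x1; split=> //=; exact: lt_le_trans phi_x1.
- by move=> x [].
- by move=> x [_ /= xe]; have := phi_le (f x - y); lra.
Qed.

(** A totally bounded set is avoided by avoiding the points of a finite net. *)
Lemma avoid_nets (U V : set X) (e : R) (Q : set E) : 0 < e -> scattered_on U e ->
  finite_nets S Q -> open V -> V !=set0 -> V `<=` U -> exists W : set X,
  [/\ open W, W !=set0, W `<=` V &
      forall x q, W x -> Q q -> e / 8 <= nrm (f x - q)].
Proof.
move=> e0 Ue Qn oV V0 VU; have e8 : 0 < e / 8 by rewrite divr_gt0.
have [L LP] := Qn _ e8.
have [W [oW W0 WV WL]] : exists W : set X, [/\ open W, W !=set0, W `<=` V &
    forall x y, W x -> y \in L -> e / 4 < nrm (f x - y)].
  elim: L {LP} => [|y L [W [oW W0 WV WL]]]; first by exists V; split.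
  have [W' [oW' W'0 W'W W'y]] := avoid_point y e0 Ue oW W0 (subset_trans WV VU).
  exists W'; split=> //; first exact: subset_trans WV.
  move=> x z W'x; rewrite inE => /predU1P[->|zL]; first exact: W'y.
  by apply: WL => //; exact: W'W.
exists W; split=> // x q Wx /LP[y yL qy].
have := nrm_dist_trans S q (f x) y; have := WL _ _ Wx yL; lra.
Qed.

Lemma dist_gauge (D : set E) : D !=set0 ->
  (forall x y, D x -> D y -> D (x + y)) -> (forall (c : K) x, D x -> D (c *: x)) ->
  gauge S (fun x => [set c | exists2 y, D y & nrm (x - y) <= c]).
Proof.
move=> [z Dz] DD DZ; split.
- by move=> x; exists (nrm (x - z)), z.
- by move=> x c [y _]; apply: le_trans; exact: nrm_ge0.
- move=> x x' c c' [y Dy xy] [y' Dy' xy']; exists (y + y'); first exact: DD.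
  rewrite opprD addrACA; apply: le_trans (nrmD _ _ _) _; lra.
- move=> k x c [y Dy xy]; exists (k *: y); first exact: DZ.
  by rewrite -scalerBr nrmZ ler_wpM2l ?nrm_ge0.
Qed.

Lemma open_shrink (V : set X) : (forall x, {for x, regular_space X}) ->
  open V -> V !=set0 -> exists W : set X,
  [/\ open W, W !=set0 & closure W `<=` V].
Proof.
move=> X_reg oV [x Vx].
have [W Wx WV] := X_reg x V (open_nbhs_nbhs (conj oV Vx)).
exists W°; split; first exact: open_interior.
  by exists x.
by apply: subset_trans WV; apply: closureS; exact: interior_subset.
Qed.

(** The game described at the top: the answer to a position [(V, Q)] is a
smaller open set avoiding [Q], together with a point of it whose image is used
to enlarge [Q]. *)
Theorem weakly_continuous_fragmented (U : set X) (e : R) :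
  locally_compact [set: X] -> hausdorff_space X ->
  0 < e -> open U -> U !=set0 ->
  exists W : set X, [/\ open W, W !=set0, W `<=` U &
    forall x y, W x -> W y -> nrm (f x - f y) <= e].
Proof.
move=> X_lc X_haus e0 oU U0; apply: contrapT => no_W.
have Ue : scattered_on U e.
  move=> W oW W0 WU; apply: contrapT => W_small; apply: no_W.
  exists W; split=> // x y Wx Wy; rewrite leNgt; apply/negP => xy.
  by apply: W_small; exists x, y.
have X_reg x : {for x, regular_space X}.
  have [B] := X_lc x I; rewrite withinET => Bx [B_cpt _].
  exact: (compact_regular X_haus B_cpt Bx).
have [u Uu] := U0.
have [B] := X_lc u I; rewrite withinET => Bu [B_cpt _].
pose V0 := U `&` B°.
have V0_open : open V0 by apply: openI => //; exact: open_interior.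
have V0_ne : V0 !=set0 by exists u.
pose good (V : set X) (Q : set E) :=
  [/\ open V, V !=set0, V `<=` V0 & finite_nets S Q].
pose answers (VQ : set X * set E) (Wx : set X * X) :=
  good VQ.1 VQ.2 -> [/\ open Wx.1, Wx.1 Wx.2, closure Wx.1 `<=` VQ.1 &
    forall x q, Wx.1 x -> VQ.2 q -> e / 8 <= nrm (f x - q)].
have /choice[F FP] : forall VQ, exists Wx, answers VQ Wx.
  move=> [V Q]; have [[oV V0' VV0 Qn]|not_good] := pselect (good V Q); last first.
    by exists (V, u) => /= /not_good.
  have VU : V `<=` U by move=> x /VV0[].
  have [W [oW W0 WV WQ]] := avoid_nets e0 Ue Qn oV V0' VU.
  have [W' [oW' [x W'x] W'W]] := open_shrink X_reg oW W0.
  exists (W', x) => _; split=> //=; first exact: subset_trans WV.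
  by move=> y q W'y; apply: WQ; apply: W'W; exact: subset_closure.
pose step n VQ := ((F VQ).1, combinations S n.+1%:R (VQ.2 `|` [set f (F VQ).2])).
pose fix game n := if n is m.+1 then step m (game m) else (V0, [set 0]).
pose V n := (game n).1; pose Q n := (game n).2; pose x n := (F (game n)).2.
have game_good n : good (V n) (Q n).
  elim: n => [|n IHn]; first by split=> //; exact: finite_nets1.
  have [oW Wx WV _] := FP (game n) IHn.
  have [_ _ VV0 Qn] := IHn; split=> //; first by exists (x n).
    by apply: subset_trans VV0; apply: subset_trans WV; exact: subset_closure.
  apply: finite_nets_combinations; apply: finite_netsU => //.
  exact: finite_nets1.
have V_closure n : closure (V n.+1) `<=` V n.
  by have [] := FP _ (game_good n).
have V_avoid n y q : V n.+1 y -> Q n q -> e / 8 <= nrm (f y - q).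
  by have [_ _ _] := FP _ (game_good n); apply.
have x_in n : V n.+1 (x n) by have [] := FP _ (game_good n).
have V_decr n m : (n <= m)%N -> V m `<=` V n.
  move=> /subnKC <-; elim: (m - n)%N => [|k IHk]; first by rewrite addn0.
  rewrite addnS; apply: subset_trans IHk; apply: subset_trans (V_closure _).
  exact: subset_closure.
have xB : (x @ \oo) B.
  exists 0%N => // n _.
  by have [_ /interior_subset] := V_decr _ _ (leq0n n.+1) _ (x_in n).
have [p [_ p_cluster]] := B_cpt (x @ \oo) _ xB.
have pV n : V n p.
  apply: V_closure => O Op; apply: p_cluster Op.
  by exists n => // m nm; apply: V_decr (x_in m); rewrite ltnS.
(* The sets [Q n] increase, and the bound on the coefficients grows with [n], so
   that their union is a linear subspace. *)
pose D : set E := [set q | exists n, Q n q].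
have QS n q : Q n q -> Q n.+1 q.
  move=> Qq; have -> : q = 1 *: q + 0 *: q by rewrite scale1r scale0r addr0.
  by apply: combinationsP; rewrite ?nrm1 ?nrm0 ?ler1n//; left.
have Q_le n m q : (n <= m)%N -> Q n q -> Q m q.
  move=> /subnKC <- Qq; elim: (m - n)%N => [|k IHk]; first by rewrite addn0.
  by rewrite addnS; exact: QS.
have Dx n : D (f (x n)).
  exists n.+1; have -> : f (x n) = 1 *: f (x n) + 0 *: f (x n).
    by rewrite scale1r scale0r addr0.
  by apply: combinationsP; rewrite ?nrm1 ?nrm0 ?ler1n//; right.
have D0 : D 0 by exists 0%N.
have DD y z : D y -> D z -> D (y + z).
  move=> [n Qy] [m Qz]; exists (maxn n m).+1.
  rewrite -[y]scale1r -[z]scale1r.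
  apply: combinationsP; rewrite ?nrm1 ?ler1n//; left.
    exact: Q_le (leq_maxl _ _) Qy.
  exact: Q_le (leq_maxr _ _) Qz.
have DZ (c : K) y : D y -> D (c *: y).
  move=> [n Qy]; pose m := maxn n (Num.truncn (nrm c)).
  have Qmy : Q m y by exact: Q_le (leq_maxl _ _) Qy.
  exists m.+1; have -> : c *: y = c *: y + 0 *: y by rewrite scale0r addr0.
  apply: combinationsP; rewrite ?nrm0//; try by left.
  rewrite (le_trans (ltW (truncnS_gt _)))// ler_nat ltnS; exact: leq_maxr.
(* A functional that vanishes at all [f (x n)] but not at [f p]. *)
have [phi [phi_le phi_p]] := gauge_functional (f p)
  (dist_gauge (ex_intro _ 0 D0) DD DZ).
have phi_D q : D q -> nrm (phi q) <= 0.
  by move=> Dq; rewrite -(mulr0 2); apply: phi_le; exists q => //; rewrite subrr nrm0.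
have phi_bounded y : nrm (phi y) <= 2 * nrm y.
  by apply: phi_le; exists 0 => //; rewrite subr0.
have p_far : e / 8 <= nrm (phi (f p)).
  by apply: phi_p => c [q [n Qq]]; apply: le_trans; exact: V_avoid (pV _) Qq.
have e8 : 0 < e / 8 by rewrite divr_gt0.
have /(continuous_nrmP S)/(_ _ e8) near_p :=
  @f_weakly (dual_of_bounded phi_bounded) p.
have range_x : (x @ \oo) (range x) by exists 0%N => // n _; exists n.
have [_ [[n _ <-] /=]] := p_cluster _ _ range_x near_p.
have := nrm_lb S (phi (f p)) (phi (f (x n))); have := phi_D _ (Dx n).
lra.
Qed.

End Fragmentation.
(** * Weakly continuous semigroups *)

Section LocalBoundedness.
Context {R : realType} {K : numFieldType} (S : real_scalars R K).
Local Notation nrm := (real_norm S).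

Lemma compact_nrm_bounded (X : topologicalType) (E : normedModType K)
    (g : X -> E) (C : set X) :
  continuous g -> compact C -> exists M, forall x, C x -> nrm (g x) <= M.
Proof.
move=> g_cont C_compact; pose h x : R^o := nrm (g x).
have h_cont : continuous h.
  move=> x; apply/cvgrPdist_lt => e e0.
  have /(continuous_nrmP S)/(_ _ e0) := g_cont x.
  apply: filterS => y; apply: le_lt_trans; rewrite ler_norml.
  have := nrm_lb S (g x) (g y); have := nrm_lb S (g y) (g x).
  by rewrite (nrm_distC S (g y)) lerNl opprB => -> ->.
have [M [_ MP]] := compact_bounded
  (continuous_compact (continuous_subspaceT h_cont) C_compact).
exists (M + 1) => x Cx; apply: le_trans (ler_norm _) _.
by apply: (MP (M + 1)); [rewrite ltrDl|exists x].
Qed.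

(** Weak continuity bounds each scalar function [phi (T t x)] on a compact
neighbourhood of [s]; uniform boundedness in the dual removes [phi], and
uniform boundedness in [E] removes [x]. *)
Lemma weak_operator_locally_bounded (E : completeNormedModType K)
    (M : topologicalMonoidType) (T : M -> bounded_operator E) (s : M) :
  locally_compact [set: M] -> weak_operator_continuous T ->
  exists C, \forall t \near s, forall x, nrm (T t x) <= C * nrm x.
Proof.
move=> M_lc T_weak; have [B] := M_lc s I; rewrite withinET => Bs [B_compact _].
have [C TC] : exists C, forall (t : {t | B t}) x, nrm (T (sval t) x) <= C * nrm x.
  apply: (@uniform_boundedness _ _ S E E {t | B t} (fun t => operator_map (T (sval t)))).
    by move=> t; exact: bounded_operator_bound.
  move=> x; apply: (@weakly_bounded_bounded _ _ S E {t | B t} (fun t => T (sval t) x)).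
  move=> phi; have [N phiN] := compact_nrm_bounded (T_weak x phi) B_compact.
  by exists N => -[t Bt] /=; exact: phiN.
by exists C; apply: filterS Bs => t Bt x; exact: (TC (exist _ t Bt) x).
Qed.

End LocalBoundedness.

(** Division is available only in [G]: as [t] tends to [s], the element
[s^-1 t r] of [G] tends to [r], so it ends up in the image of [W], which is a
neighbourhood of [r] in [G] because [r] is interior. *)
Lemma embedding_right_translate (M : topologicalMonoidType)
    (G : topologicalGroupType) (iota : M -> G) (W : set M) (r s : M) :
  closed_embedding iota -> open W -> W r ->
  (interior (range iota)) (iota r) ->
  \forall t \near s, exists2 w, W w & (t * r = s * w)%g.
Proof.
move=> [[iota1 iotaM] iota_inj iota_cont _ iota_open] oW Wr r_int.
have [V oV VE] := iota_open W oW.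
have Vr : V (iota r) by have : (iota @` W) (iota r) by [exists r]; rewrite VE => -[].
have iotaW : nbhs (iota r) (iota @` W).
  by rewrite VE; apply: filterI => //; exact: open_nbhs_nbhs.
pose g (t : M) : G := ((iota s)^-1 * (iota t * iota r))%g.
have g_s : g s = iota r by rewrite /g mulgA mulVg mul1g.
have mul_cont (a b : M -> G) : {for s, continuous a} -> {for s, continuous b} ->
    {for s, continuous (fun t => a t * b t)%g}.
  move=> a_cont b_cont.
  exact: (cvg_comp2 a_cont b_cont (mulg_continuous (a s, b s))).
have g_cont : {for s, continuous g}.
  apply: (mul_cont (fun=> _)); first exact: cvg_cst.
  by apply: mul_cont; [exact: iota_cont|exact: cvg_cst].
have g_near : \forall t \near s, (iota @` W) (g t) by apply: g_cont; rewrite g_s.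
apply: filterS g_near => t [w Ww wE]; exists w => //.
by apply: iota_inj; rewrite !iotaM wE /g mulgA mulgV mul1g.
Qed.

Lemma near_one_interior (M : topologicalMonoidType)
    (G : topologicalGroupType) (iota : M -> G) (O : set M) :
  closed_embedding iota -> positive_in_identity (range iota) -> nbhs 1%g O ->
  exists U : set M, [/\ open U, U !=set0, U `<=` O &
    forall r, U r -> (interior (range iota)) (iota r)].
Proof.
move=> [[iota1 iotaM] iota_inj iota_cont _ iota_open] iota_pos.
rewrite nbhsE => -[N [oN N1] NO].
have [V oV VE] := iota_open N oN.
have V1 : nbhs 1%g V.
  rewrite -iota1; apply: open_nbhs_nbhs; split=> //.
  by have : (iota @` N) (iota 1%g) by [exists 1%g]; rewrite VE => -[].
have [g g_int] := iota_pos V V1.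
have [m _ mg] : range iota g by have [] := interior_subset g_int.
exists (iota @^-1` interior (V `&` range iota)); split.
- by apply: open_comp => [x _|]; [exact: iota_cont|exact: open_interior].
- by exists m; rewrite /preimage /= mg.
- move=> r /interior_subset; rewrite -VE => -[r' Nr' /iota_inj <-]; exact: NO.
- by move=> r; apply: filterS => x [].
Qed.

Theorem theorem3p1 (R : realType) (K : numFieldType)
    (K_scalars : real_or_complex R K)
    (E : completeNormedModType K)
    (M : topologicalMonoidType)
    (M_lc : locally_compact [set: M]) (M_haus : hausdorff_space M)
    (G : topologicalGroupType)
    (G_lc : locally_compact [set: G]) (G_haus : hausdorff_space G)
    (iota : M -> G) (M_ext : closed_embedding iota)
    (M_pos : positive_in_identity (range iota))
    (T : M -> bounded_operator E) (T_semigroup : operator_semigroup T) :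
  weak_operator_continuous T -> strong_operator_continuous T.
Proof.
move=> T_weak; have [S] := real_or_complex_scalars K_scalars.
have [T1 TM] := T_semigroup.
move=> x s; apply/(continuous_nrmP S) => e e0.
have [C TC] := weak_operator_locally_bounded S s M_lc T_weak.
have TsC : forall x, real_norm S (T s x) <= C * real_norm S x := nbhs_singleton TC.
(* The gauge of the seminorm [limsup_(t -> s) |T t y - T s y|]. *)
pose P (y : E) : set R :=
  [set c | 0 <= c /\ \forall t \near s, real_norm S (T s y - T t y) <= c].
have P_norm y : P y (2 * `|C| * real_norm S y).
  split; first by rewrite !mulr_ge0// nrm_ge0.
  apply: filterS TC => t TtC; apply: le_trans (nrmB _ _ _) _.
  have := TsC y; have := TtC y; have := ler_wpM2r (nrm_ge0 S y) (ler_norm C).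
  lra.
have P_gauge : gauge S P.
  split=> [y|y c []//|y z c d [c0 yc] [d0 zd]|k y c [c0 yc]].
  - by exists (2 * `|C| * real_norm S y).
  - split; first exact: addr_ge0.
    apply: filterS2 yc zd => t yc zd.
    by rewrite !linearD addrACA; apply: le_trans (nrmD _ _ _) (lerD yc zd).
  - split; first by rewrite mulr_ge0// nrm_ge0.
    apply: filterS yc => t yc.
    by rewrite !linearZ -scalerDr nrmZ ler_wpM2l// nrm_ge0.
have [phi [phi_le phi_x]] := gauge_functional x P_gauge.
have phi_bounded y : real_norm S (phi y) <= 2 * (2 * `|C|) * real_norm S y.
  by rewrite -mulrA; exact: phi_le.
pose phi_dual := dual_of_bounded phi_bounded.
(* As [d] is arbitrary, this says that [phi x = 0]. *)
have phi_x_le d : 0 < d -> real_norm S (phi x) <= 2 * (`|C| * d) + d.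
  move=> d0.
  have /(continuous_nrmP S)/(_ _ d0) near1 := T_weak x phi_dual 1%g.
  have [U [oU U0 U_near U_int]] := near_one_interior M_ext M_pos near1.
  have [W [oW [r Wr] WU W_small]] :=
    weakly_continuous_fragmented S (T_weak x) M_lc M_haus d0 oU U0.
  have Pr : P (T r x) (`|C| * d).
    split; first by rewrite mulr_ge0// ltW.
    apply: filterS (embedding_right_translate s M_ext oW Wr (U_int _ (WU _ Wr))).
    move=> t [w Ww trE]; rewrite -!TM trE !TM -linearB.
    apply: le_trans (TsC _) _.
    apply: le_trans (ler_wpM2r (nrm_ge0 S _) (ler_norm C)) _.
    by apply: ler_wpM2l; [exact: normr_ge0|exact: W_small].
  have := phi_le _ _ Pr; have := U_near _ (WU _ Wr).
  rewrite /= T1; have := nrm_lb S (phi x) (phi (T r x)); lra.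
have [c [[c0 cP] ce]] : exists c, P x c /\ c < e.
  apply: contrapT => no_c; have : e <= real_norm S (phi x).
    apply: phi_x => c Pc; rewrite leNgt; apply/negP => ce.
    by apply: no_c; exists c.
  have C2 : 0 < 2 * `|C| + 1 by rewrite ltr_wpDl// mulr_ge0.
  have d0 : 0 < e / 2 / (2 * `|C| + 1) by rewrite !divr_gt0.
  have := phi_x_le _ d0; set d := _ / (_ + 1) => phi_d.
  have dE : d * (2 * `|C| + 1) = e / 2 by rewrite /d divfK// gt_eqF.
  by move: phi_d dE; lra.
by apply: filterS cP => t ct; exact: le_lt_trans ce.
Qed.
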